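(* Let $k$ be a field and $l\ge1$. Every $w\in\mathcal A^l$ has a unique immediate successor in $\mathcal A^l$ and a unique immediate predecessor in $\mathcal A^l$.
   Context: For a field $k$, let $F_k$ be the free monoid of all finite words with letters in $k$, $F_k^l$ the words of length $l$. For $\alpha\in k$ put $M_\alpha=\begin{pmatrix}0&-1\\1&\alpha\end{pmatrix}$ and $\pi(\alpha_1\cdots\alpha_l)=M_{\alpha_1}\cdots M_{\alpha_l}\in\mathrm{SL}_2(k)$ (identity for the empty word). Let $\mathcal A$ be the set of words $w$ with $\pi(w)$ having lower-right entry $0$ (equivalently $\pi(w)=\begin{pmatrix}a&-b\\ b^{-1}&0\end{pmatrix}$, $a\in k$, $b\in k^*$), and $\mathcal A^l=\mathcal A\cap F_k^l$. Given words $w=\alpha_0\alpha_1\cdots\alpha_{l-1}$ and $w'=\alpha_1\cdots\alpha_{l-1}\alpha_l$ in $F_k^l$, $w'$ is called an immediate successor of $w$ and $w$ an immediate predecessor of $w'$. *)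

(* Defs.v *)
From mathcomp Require Import all_boot all_order all_algebra.

Set Implicit Arguments.
Unset Strict Implicit.
Unset Printing Implicit Defensive.

Import GRing.Theory.
Local Open Scope ring_scope.

(* The free monoid of words with letters in k is seq k, with concatenation. *)

Definition letter_mx (k : fieldType) (alpha : k) : 'M[k]_2 :=
  \matrix_(i < 2, j < 2)
    (nth [::] [:: [:: 0; -1];
                  [:: 1; alpha]] i)`_j.

Definition word_mx (k : fieldType) (w : seq k) : 'M[k]_2 :=
  \prod_(alpha <- w) letter_mx alpha.

Lemma det_letter_mx (k : fieldType) (alpha : k) : \det (letter_mx alpha) = 1.
Proof.
rewrite (expand_det_row _ 0) !big_ord_recl big_ord0 /cofactor !det_mx11 !mxE /=.
by rewrite mul0r add0r addr0 /= expr1 mulr1 mulrNN mulr1.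
Qed.

Lemma det_word_mx (k : fieldType) (w : seq k) : \det (word_mx w) = 1.
Proof.
rewrite /word_mx; elim: w => [|alpha w IHw]; first by rewrite big_nil det1.
by rewrite big_cons det_mulmx IHw det_letter_mx mulr1.
Qed.

(* Indices count from 0: (1, 1) is the lower-right entry. *)
Definition calA (k : fieldType) : {pred seq k} :=
  [pred w | word_mx w 1 1 == 0].
Arguments calA : clear implicits.

Definition calA_len (k : fieldType) (l : nat) : {pred seq k} :=
  [pred w | (w \in calA k) && (size w == l)].
Arguments calA_len : clear implicits.

(* w = alpha_0 u and w' = u alpha_l with u = alpha_1 ... alpha_(l-1), which is
   empty when l = 1; the two words automatically have the same length. *)
Definition is_immediate_successor (k : fieldType) (w' w : seq k) : Prop :=
  exists (alpha0 : k) (u : seq k) (alphal : k),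
    w = alpha0 :: u /\ w' = rcons u alphal.

Definition is_immediate_predecessor (k : fieldType) (w w' : seq k) : Prop :=
  is_immediate_successor w' w.

(* Main.v *)
(* Write P = pi(u).  The lower-right entry of pi(a u) is P01 + a P11 and that
   of pi(u a) is a P11 - P10.  If P11 = 0, then either of these vanishing would
   give det P = 0; so as soon as some extension of u by a letter on one side
   lies in A, P11 is invertible and each side admits exactly one such letter. *)
Require Import Defs.
From mathcomp Require Import all_boot all_order all_algebra.

Set Implicit Arguments.
Unset Strict Implicit.
Unset Printing Implicit Defensive.

Import GRing.Theory.
Local Open Scope ring_scope.

Lemma word_mx_cons11 (k : fieldType) (a : k) (u : seq k) :
  word_mx (a :: u) 1 1 = word_mx u 0 1 + a * word_mx u 1 1.
Proof.
rewrite /word_mx big_cons mxE !big_ord_recl big_ord0 !mxE /= mul1r addr0.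
by have -> : lift ord0 ord0 = 1 :> 'I_2 by apply/val_inj.
Qed.

Lemma word_mx_rcons11 (k : fieldType) (u : seq k) (a : k) :
  word_mx (rcons u a) 1 1 = a * word_mx u 1 1 - word_mx u 1 0.
Proof.
rewrite /word_mx -cats1 big_cat big_seq1 mxE !big_ord_recl big_ord0 !mxE /=.
rewrite mulrN1 addr0 addrC mulrC.
by have -> : lift ord0 ord0 = 1 :> 'I_2 by apply/val_inj.
Qed.

Lemma word_mx_det_entries (k : fieldType) (u : seq k) :
  word_mx u 0 0 * word_mx u 1 1 - word_mx u 0 1 * word_mx u 1 0 = 1.
Proof.
rewrite -(det_word_mx u) (expand_det_row _ 0) !big_ord_recl big_ord0 /cofactor.
rewrite !det_mx11 !mxE /= expr0 expr1 mul1r mulN1r mulrN addr0.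
(* These lifts carry the single index of a 1x1 minor back to the 2x2 matrix. *)
have -> : lift (lift ord0 ord0) 0 = 0 :> 'I_2 by apply/val_inj.
by have -> : lift 0 0 = 1 :> 'I_2 by apply/val_inj.
Qed.

(** Otherwise the right column of pi(u) would vanish, against determinant 1. *)
Lemma calA_cons_neq0 (k : fieldType) (a : k) (u : seq k) :
  a :: u \in calA k -> word_mx u 1 1 != 0.
Proof.
rewrite inE word_mx_cons11 => /eqP Aau; apply/eqP => d0.
move: Aau (word_mx_det_entries u); rewrite d0 !mulr0 addr0 => ->.
by rewrite mul0r subr0 => /eqP; rewrite eq_sym oner_eq0.
Qed.

(** Here it is the bottom row of pi(u) that would vanish. *)
Lemma calA_rcons_neq0 (k : fieldType) (u : seq k) (a : k) :
  rcons u a \in calA k -> word_mx u 1 1 != 0.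
Proof.
rewrite inE word_mx_rcons11 => /eqP Aua; apply/eqP => d0.
move: Aua (word_mx_det_entries u); rewrite d0 !mulr0 sub0r => /eqP.
rewrite oppr_eq0 => /eqP ->.
by rewrite mulr0 subr0 => /eqP; rewrite eq_sym oner_eq0.
Qed.

(** An affine equation in [a] with nonzero slope has one root. Read backwards the equivalence
    validates a witness, read forwards it yields uniqueness. *)
Lemma calA_consE (k : fieldType) (a : k) (u : seq k) :
  word_mx u 1 1 != 0 ->
  (a :: u \in calA k) = (a == - word_mx u 0 1 / word_mx u 1 1).
Proof.
by move=> d0; rewrite inE word_mx_cons11 addrC addr_eq0
  (can2_eq (mulfK d0) (divfK d0)).
Qed.

Lemma calA_rconsE (k : fieldType) (u : seq k) (a : k) :
  word_mx u 1 1 != 0 ->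
  (rcons u a \in calA k) = (a == word_mx u 1 0 / word_mx u 1 1).
Proof.
by move=> d0; rewrite inE word_mx_rcons11 subr_eq0
  (can2_eq (mulfK d0) (divfK d0)).
Qed.

Theorem theorem2p9 (k : fieldType) (l : nat) (hl : (1 <= l)%N)
    (w : seq k) (hw : w \in calA_len k l) :
  (exists! w' : seq k, w' \in calA_len k l /\ is_immediate_successor w' w) /\
  (exists! w' : seq k, w' \in calA_len k l /\ is_immediate_predecessor w' w).
Proof.
move: hw => /andP[Aw /eqP sz_w]; split.
- case: w Aw sz_w => [|a u] Aau sz_u; first by rewrite -sz_u in hl.
  have d0 := calA_cons_neq0 Aau.
  exists (rcons u (word_mx u 1 0 / word_mx u 1 1)); split.
    split; first by apply/andP; rewrite calA_rconsE // size_rcons -sz_u.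
    by exists a, u, (word_mx u 1 0 / word_mx u 1 1).
  (* Cancelling the first letter of [w] forces the shared middle word to be [u], so only the
     appended letter is free. *)
  move=> w' [/andP[Aw' _] [_ [v [c [[_ uv] w'E]]]]].
  by move: Aw'; rewrite w'E -uv calA_rconsE // => /eqP ->.
- case/lastP: w Aw sz_w => [|u a] Aua sz_u; first by rewrite -sz_u in hl.
  have d0 := calA_rcons_neq0 Aua.
  exists (- word_mx u 0 1 / word_mx u 1 1 :: u); split.
    split; first by apply/andP; rewrite calA_consE // -sz_u size_rcons.
    (* Now [w] is itself the successor, so its own last letter [a] is the appended one. *)
    by exists (- word_mx u 0 1 / word_mx u 1 1), u, a.
  (* Cancelling the last letter of [w] leaves only the prepended letter [c] to determine. *)
  move=> w' [/andP[Aw' _] [c [v [b [w'E /rcons_inj[uv _]]]]]].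
  by move: Aw'; rewrite w'E -uv calA_consE // => /eqP ->.
Qed.
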